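(* Let $\mathbf F$ be a Fraïssé structure. The following are equivalent: (i) The flow $\mathrm{Aut}(\mathbf F)\curvearrowright R(\mathrm{Aut}(\mathbf F))$ has a fixed point. (ii) For all $\mathbf A,\mathbf B,\mathbf Z\in\mathrm{Age}(\mathbf F)$ and every finite coloring $\gamma$ of the joint embedding patterns of $\mathbf A$ and $\mathbf Z$, there exists a joint embedding $\langle b,z\rangle$ of $\mathbf B$ and $\mathbf Z$ such that the coloring $a\mapsto\gamma([a,z])$ is constant on $\binom{b(\mathbf B)}{\mathbf A}$. When $\mathrm{Aut}(\mathbf F)$ is Roelcke-precompact, these conditions are equivalent to: (iii) For all $\mathbf A,\mathbf B,\mathbf Z\in\mathrm{Age}(\mathbf F)$, there exists a joint embedding $\langle b,z\rangle$ of $\mathbf B$ and $\mathbf Z$ such that the coloring $a\mapsto[a,z]$ is constant on $\binom{b(\mathbf B)}{\mathbf A}$.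
   Context: Structures. Languages are first-order and relational; a structure is a non-empty set with interpretations of the relation symbols. An embedding is an isomorphism onto its image; $\binom{\mathbf B}{\mathbf A}$ denotes the set of all embeddings of $\mathbf A$ into $\mathbf B$. A Fraïssé structure is a countable ultrahomogeneous structure (every isomorphism between finite substructures extends to an automorphism). $\mathrm{Age}(\mathbf F)$ is the set of all finite substructures of $\mathbf F$ (considered up to isomorphism). $\mathrm{Aut}(\mathbf F)$ is a topological group for which the pointwise stabilizers of finite substructures form a basis of neighborhoods of the identity. Joint embeddings. A joint embedding $\langle a,z\rangle$ of $\mathbf A,\mathbf Z\in\mathrm{Age}(\mathbf F)$ is a pair of embeddings $a:\mathbf A\to\mathbf C$, $z:\mathbf Z\to\mathbf C$ into a common structure $\mathbf C$, isomorphic to a member of $\mathrm{Age}(\mathbf F)$, with $C=a(A)\cup z(Z)$. When $a,z$ take values in a larger structure, $\langle a,z\rangle$ is understood with common range the substructure on $a(A)\cup z(Z)$. Two joint embeddings $\langle a,z\rangle$, $\langle a',z'\rangle$ with common ranges $\mathbf C,\mathbf C'$ are isomorphic when there is an isomorphism $c:\mathbf C\to\mathbf C'$ with $a'=c\circ a$, $z'=c\circ z$. The isomorphism type of $\langle a,z\rangle$ is its joint embedding pattern $[a,z]$. A finite coloring is a map with finite range. Roelcke compactification. For a topological group $G$, the Roelcke uniformity is the finest uniformity coarser than both the left uniformity (entourages $\{(g,h):g^{-1}h\in U\}$) and the right uniformity (entourages $\{(g,h):gh^{-1}\in U\}$), $U$ ranging over neighborhoods of the identity. $G$ is Roelcke-precompact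 when its completion for the Roelcke uniformity is compact. $\mathrm{Ro}_b(G)$ is the C$^*$-algebra (supremum norm) of bounded functions $G\to\mathbb C$ uniformly continuous for the Roelcke uniformity. $R(G)$ is its Gelfand space (the space of unital C$^*$-homomorphisms $\phi:\mathrm{Ro}_b(G)\to\mathbb C$ with the weak$^*$ topology), on which $G$ acts continuously by $(g\cdot\phi)(f)=\phi(g^{-1}\cdot f)$, where $(g\cdot f)(h)=f(g^{-1}h)$; this extends the left-regular action of $G$ through the map $g\mapsto(f\mapsto f(g))$, whose image is dense. *)

(* Defs.v *)
From HB Require Import structures.
From mathcomp Require Import all_boot all_order all_algebra.
From mathcomp Require Import all_classical all_reals all_analysis.
From mathcomp Require Import complex.

Set Implicit Arguments.
Unset Strict Implicit.
Unset Printing Implicit Defensive.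

Import Order.TTheory GRing.Theory Num.Theory.
Import numFieldNormedType.Exports.
Local Open Scope classical_set_scope.
Local Open Scope ring_scope.

Record language := Language { symbol : Type; arity : symbol -> nat }.

Record structure (L : language) := Structure {
  carrier :> Type;
  interp : forall r : symbol L, set ('I_(arity r) -> carrier);
  carrier_neq0 : [set: carrier] !=set0 }.

Section Structures.
Variable L : language.
Implicit Types A B C D F : structure L.

Definition is_embedding A B (f : A -> B) :=
  injective f /\
  forall (r : symbol L) (t : 'I_(arity r) -> A),
    interp (f \o t) <-> interp t.

Record embedding A B := Embedding {
  emb_fun :> A -> B;
  emb_is_embedding : is_embedding emb_fun }.

Definition is_isomorphism A B (f : A -> B) :=
  is_embedding f /\ range f = [set: B].

Lemma id_is_embedding A : is_embedding (@id A).
Proof. by split=> [x y|r t]. Qed.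

Lemma comp_is_embedding A B C (f : A -> B) (g : B -> C) :
  is_embedding f -> is_embedding g -> is_embedding (g \o f).
Proof.
move=> [fi fr] [gi gr]; split; first exact: inj_comp.
move=> r t; have -> : ((g \o f) \o t) = g \o (f \o t) by [].
by rewrite gr fr.
Qed.

Definition emb_comp A B C (g : embedding B C) (f : embedding A B) :=
  Embedding (comp_is_embedding (emb_is_embedding f) (emb_is_embedding g)).

Definition substructure D (S : set D) (S0 : S !=set0) : structure L.
Proof.
refine (@Structure L {x : D | S x}
  (fun r => [set t | interp (fun i => sval (t i))]) _).
by case: S0 => x Sx; exists (exist _ x Sx).
Defined.

Definition sub_incl D (S : set D) (S0 : S !=set0) :
  embedding (substructure S0) D.
Proof.
by exists (fun x => sval x); split=> // -[x Sx] [y Sy] /= xy; exact: eq_exist.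
Defined.

Lemma range_neq0 A B (f : A -> B) : range f !=set0.
Proof. by case: (carrier_neq0 A) => x _; exists (f x), x. Qed.

Definition image_structure B D (b : embedding B D) : structure L :=
  substructure (range_neq0 b).

Definition ultrahomogeneous F :=
  forall (S T : set F) (S0 : S !=set0) (T0 : T !=set0)
         (f : substructure S0 -> substructure T0),
    finite_set S -> finite_set T -> is_isomorphism f ->
    exists2 g : F -> F, is_isomorphism g &
      forall x : substructure S0, g (sval x) = sval (f x).

Definition fraisse_structure F := countable [set: F] /\ ultrahomogeneous F.

(* [A] is isomorphic to a member of Age(F). *)
Definition in_age F A :=
  exists (S : set F) (S0 : S !=set0),
    finite_set S /\ exists f : A -> substructure S0, is_isomorphism f.

Section JointEmbeddings.
Variable F : structure L.
Variables A Z : structure L.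

Record joint_embedding := JointEmbedding {
  je_range : structure L;
  je_left : embedding A je_range;
  je_right : embedding Z je_range;
  je_cover : range je_left `|` range je_right = [set: je_range];
  je_in_age : in_age F je_range }.

Definition je_iso (j j' : joint_embedding) :=
  exists c : je_range j -> je_range j',
    [/\ is_isomorphism c,
        forall x, c (je_left j x) = je_left j' x &
        forall x, c (je_right j x) = je_right j' x].

(* The isomorphism type of a joint embedding is its isomorphism class. *)
Definition pattern := {P : set joint_embedding | exists j, P = je_iso j}.

Definition pattern_of (j : joint_embedding) : pattern :=
  exist _ (je_iso j) (ex_intro _ j erefl).

End JointEmbeddings.

Lemma is_isomorphism_id A : is_isomorphism (@id A).
Proof.
split; first exact: id_is_embedding.
by apply/seteqP; split=> // x _; exists x.
Qed.

Lemma is_isomorphism_comp A B C (f : A -> B) (g : B -> C) :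
  is_isomorphism f -> is_isomorphism g -> is_isomorphism (g \o f).
Proof.
move=> [ef sf] [eg sg]; split; first exact: comp_is_embedding.
apply/seteqP; split=> // z _.
have [y _ <-] : range g z by rewrite sg.
have [x _ <-] : range f y by rewrite sf.
by exists x.
Qed.

Lemma is_isomorphism_inv A B (f : A -> B) : is_isomorphism f ->
  exists g : B -> A, [/\ is_isomorphism g, cancel f g & cancel g f].
Proof.
move=> [[fi fr] fs].
have H y : exists x, f x = y.
  by have [x _ <-] : range f y; [rewrite fs | exists x].
pose g y := sval (cid (H y)).
have gK : cancel g f by move=> y; rewrite /g; case: (cid _).
have fK : cancel f g by move=> x; apply: fi; rewrite gK.
exists g; split=> //; split.
  split; first exact: can_inj gK.
  move=> r t; rewrite -fr.
  by have -> : f \o (g \o t) = t by apply/funext => i /=; rewrite gK.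
by apply/seteqP; split=> // x _; exists (f x).
Qed.

Lemma pattern_ofP F A Z (j j' : joint_embedding F A Z) :
  pattern_of j = pattern_of j' <-> je_iso j j'.
Proof.
have refl (k : joint_embedding F A Z) : je_iso k k.
  by exists id; split=> //; exact: is_isomorphism_id.
have trans (k1 k2 k3 : joint_embedding F A Z) :
    je_iso k1 k2 -> je_iso k2 k3 -> je_iso k1 k3.
  move=> [c [ci cl cr]] [d [di dl dr]]; exists (d \o c); split=> [|x|x] /=.
  - exact: is_isomorphism_comp.
  - by rewrite cl dl.
  - by rewrite cr dr.
have sym (k k' : joint_embedding F A Z) : je_iso k k' -> je_iso k' k.
  move=> [c [/is_isomorphism_inv[d [di cK _]] cl cr]].
  by exists d; split=> // x; rewrite -?cl -?cr cK.
split=> [[e]|jj']; first by rewrite e; exact: refl.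
apply: eq_exist; apply/seteqP; split=> k jk.
  exact: trans (sym _ _ jj') jk.
exact: trans jj' jk.
Qed.

Lemma in_age_substructure F D (S : set D) (S0 : S !=set0) :
  in_age F D -> in_age F (substructure S0).
Proof.
move=> [T [T0 [Tfin [f [[fi fr] fs]]]]].
pose h (x : D) : F := sval (f x).
have hi : injective h.
  by move=> x y; rewrite /h => hxy; apply: fi; case: (f x) (f y) hxy
    => [u Tu] [v Tv] /= uv; exact: eq_exist.
have h0 : h @` S !=set0 by case: S0 => x Sx; exists (h x), x.
exists (h @` S), h0; split.
  by apply: sub_finite_set Tfin => _ [x _ <-]; exact: svalP (f x).
have hS (x : substructure S0) : (h @` S) (h (sval x)).
  by exists (sval x) => //; exact: svalP x.
exists (fun x => exist _ (h (sval x)) (hS x)); split; first split.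
- move=> [x Sx] [y Sy] /= [/hi xy]; exact: eq_exist.
- by move=> r t /=; rewrite -(fr r (fun i => sval (t i))).
- apply/seteqP; split=> // -[y yS] _; have [x Sx xy] := yS.
  by exists (exist _ x Sx) => //; exact: eq_exist.
Qed.

(* The joint embedding <a, z> attached to embeddings into a larger structure D:
   its common range is the substructure of D on a(A) `|` z(Z). *)
Section JointIn.
Variables (F A Z D : structure L) (FD : in_age F D).
Variables (a : embedding A D) (z : embedding Z D).

Let S : set D := range a `|` range z.

Let S0 : S !=set0.
Proof. by case: (range_neq0 a) => x ax; exists x; left. Qed.

Let corestrict B (f : embedding B D) (fS : range f `<=` S) :
  embedding B (substructure S0).
Proof.
exists (fun x => exist _ (f x) (fS _ (imageT f x))); split.
  by move=> x y [/(emb_is_embedding f).1].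
by move=> r t; exact: (emb_is_embedding f).2.
Defined.

Definition joint_in : joint_embedding F A Z.
Proof.
refine (@JointEmbedding F A Z (substructure S0)
  (corestrict (@subsetUl _ _ _)) (corestrict (@subsetUr _ _ _))
  _ (in_age_substructure S0 FD)).
apply/seteqP; split=> // -[x xS] _.
by have [[y _ e]|[y _ e]] := xS; [left|right]; exists y => //; exact: eq_exist.
Defined.

End JointIn.

(* [a, z], for a joint embedding <b, z> of B and Z and a in binom(b(B), A). *)
Definition sub_pattern F A B Z (j : joint_embedding F B Z)
    (a : embedding A (image_structure (je_left j))) : pattern F A Z :=
  pattern_of (joint_in (je_in_age j)
    (emb_comp (sub_incl (range_neq0 (je_left j))) a) (je_right j)).

End Structures.

HB.mixin Record isTopologicalGroup G of Group G & Topological G := {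
  mulg_continuous : continuous (fun x : G * G => (x.1 * x.2)%g);
  invg_continuous : continuous (fun x : G => x^-1%g) }.

#[short(type="topologicalGroupType")]
HB.structure Definition TopologicalGroup :=
  {G of Group G & Topological G & isTopologicalGroup G}.

Section Uniformities.
Local Open Scope relation_scope.

(* The axioms of [uniformType], for a uniformity given as a bare set of
   entourages. *)
Record is_uniformity T (E : set_system (T * T)) : Prop := IsUniformity {
  uniformity_filter : Filter E;
  uniformity_diagonal : forall A, E A -> diagonal `<=` A;
  uniformity_inv : forall A, E A -> E A^-1;
  uniformity_split : forall A, E A -> exists2 B, E B & B \; B `<=` A }.

End Uniformities.

Section RoelckeUniformity.
Variable G : topologicalGroupType.

Definition left_uniformity : set_system (G * G) :=
  filter_from (nbhs (1%g : G)) (fun U => [set x | U (x.1^-1 * x.2)%g]).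

Definition right_uniformity : set_system (G * G) :=
  filter_from (nbhs (1%g : G)) (fun U => [set x | U (x.1 * x.2^-1)%g]).

Definition coarser_than_both (E : set_system (G * G)) :=
  [/\ is_uniformity E, E `<=` left_uniformity & E `<=` right_uniformity].

(* The uniformities coarser than both form a directed family, so their finest
   element is their union. *)
Definition roelcke_uniformity : set_system (G * G) :=
  \bigcup_(E in [set E | coarser_than_both E]) E.

Lemma left_uniformity_filter : Filter left_uniformity.
Proof.
apply: filter_from_filter; first by exists setT; exact: filterT.
by move=> U V nU nV; exists (U `&` V) => //; exact: filterI.
Qed.

Lemma right_uniformity_filter : Filter right_uniformity.
Proof.
apply: filter_from_filter; first by exists setT; exact: filterT.
by move=> U V nU nV; exists (U `&` V) => //; exact: filterI.
Qed.

Lemma coarser_than_both_join E1 E2 :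
  coarser_than_both E1 -> coarser_than_both E2 ->
  exists E, [/\ coarser_than_both E, E1 `<=` E & E2 `<=` E].
Proof.
move=> [u1 l1 r1] [u2 l2 r2].
have F1 := uniformity_filter u1; have F2 := uniformity_filter u2.
pose E V := exists A B, [/\ E1 A, E2 B & A `&` B `<=` V].
exists E; split; first split; first split.
- split.
  + by exists setT, setT; split=> //; exact: filterT.
  + move=> P Q [A [B [EA EB AB]]] [A' [B' [EA' EB' AB']]].
    exists (A `&` A'), (B `&` B'); split; [exact: filterI|exact: filterI|].
    by move=> x [[? ?] [? ?]]; split; [exact: AB|exact: AB'].
  + move=> P Q PQ [A [B [EA EB AB]]]; exists A, B; split=> //.
    exact: subset_trans AB PQ.
- move=> V [A [B [EA EB AB]]] x dx; apply: AB; split.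
    exact: (uniformity_diagonal u1 EA).
  exact: (uniformity_diagonal u2 EB).
- move=> V [A [B [EA EB AB]]]; exists (A^-1)%relation, (B^-1)%relation; split.
  + exact: (uniformity_inv u1).
  + exact: (uniformity_inv u2).
  + by move=> x [? ?]; exact: AB.
- move=> V [A [B [EA EB AB]]].
  have [A' EA' AA'] := uniformity_split u1 EA.
  have [B' EB' BB'] := uniformity_split u2 EB.
  exists (A' `&` B'); first by exists A', B'; split.
  move=> [x y] [z [? ?] [? ?]]; apply: AB; split.
    by apply: AA'; exists z.
  by apply: BB'; exists z.
- have FL := left_uniformity_filter.
  move=> V [A [B [/l1 EA /l2 EB AB]]]; apply: filterS AB _; exact: filterI.
- have FR := right_uniformity_filter.
  move=> V [A [B [/r1 EA /r2 EB AB]]]; apply: filterS AB _; exact: filterI.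
- by move=> V EV; exists V, setT; rewrite setIT; split=> //; exact: filterT.
- by move=> V EV; exists setT, V; rewrite setTI; split=> //; exact: filterT.
Qed.

Lemma coarser_than_both_trivial : coarser_than_both [set [set: G * G]].
Proof.
split; first split.
- split=> //.
  + by move=> P Q -> ->; rewrite setIT.
  + by move=> P Q PQ P1; apply/seteqP; split=> // x _; apply: PQ; rewrite P1.
- by move=> A ->.
- by move=> A ->; apply/seteqP; split.
- by move=> A ->; exists setT.
- by move=> A ->; exact: (@filterT _ _ left_uniformity_filter).
- by move=> A ->; exact: (@filterT _ _ right_uniformity_filter).
Qed.

Lemma roelcke_uniformity_coarser : coarser_than_both roelcke_uniformity.
Proof.
split; first split.
- split.
  + exists [set [set: G * G]] => //; exact: coarser_than_both_trivial.
  + move=> P Q [E1 c1 EP] [E2 c2 EQ].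
    have [E [c s1 s2]] := coarser_than_both_join c1 c2.
    have FE : Filter E by case: c => /uniformity_filter.
    by exists E => //; apply: filterI; [exact: s1|exact: s2].
  + move=> P Q PQ [E c EP]; exists E => //.
    have FE : Filter E by case: c => /uniformity_filter.
    exact: filterS PQ EP.
- by move=> A [E [u _ _] EA]; exact: (uniformity_diagonal u EA).
- by move=> A [E c EA]; exists E => //; case: c => u _ _; exact: (uniformity_inv u).
- move=> A [E c EA]; have [B EB BA] : exists2 B, E B & (B \; B `<=` A)%relation.
    by case: c => u _ _; exact: (uniformity_split u).
  by exists B => //; exists E.
- by move=> V [E [_ l _]]; exact: l.
- by move=> V [E [_ _ r]]; exact: r.
Qed.

Lemma roelcke_uniformity_finest E :
  coarser_than_both E -> E `<=` roelcke_uniformity.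
Proof. by move=> c V EV; exists E. Qed.

(* Left translations are uniform automorphisms. *)
Lemma roelcke_uniformity_translate (g : G) (V : set (G * G)) :
  roelcke_uniformity V ->
  roelcke_uniformity [set x | V (g * x.1, g * x.2)%g].
Proof.
move=> [E [u l r] EV].
pose t (x : G * G) := (g * x.1, g * x.2)%g.
pose E' := [set W | exists2 A, E A & t @^-1` A `<=` W].
have FE := uniformity_filter u.
exists E'; last by exists V.
split; first split.
- split.
  + by exists setT => //; exact: filterT.
  + move=> P Q [A EA AP] [B EB BQ]; exists (A `&` B); first exact: filterI.
    by move=> x [? ?]; split; [exact: AP|exact: BQ].
  + by move=> P Q PQ [A EA AP]; exists A => //; exact: subset_trans AP PQ.
- move=> W [A EA AW] [x y] /= xy; apply: AW.
  by apply: (uniformity_diagonal u EA); rewrite /t/=; congr (g * _)%g.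
- move=> W [A EA AW]; exists (A^-1)%relation; first exact: (uniformity_inv u).
  by move=> x ?; exact: AW.
- move=> W [A EA AW]; have [B EB BA] := uniformity_split u EA.
  exists (t @^-1` B); first by exists B.
  by move=> [x y] [z ? ?]; apply: AW; apply: BA; exists (g * z)%g.
- move=> W [A /l [U nU UA] AW]; exists U => // x Ux; apply: AW; apply: UA => /=.
  by rewrite invgM -mulgA mulKg.
- move=> W [A /r [U nU UA] AW].
  exists [set x | U (g * x * g^-1)%g]; last first.
    by move=> x Ux; apply: AW; apply: UA; rewrite /= invgM !mulgA in Ux *.
  have cg : continuous (fun x : G => (g * x * g^-1)%g).
    move=> x; pose m (p : G * G) := (p.1 * p.2)%g.
    have cl : (g * y)%g @[y --> x] --> (g * x)%g.
      apply: (@cvg_comp _ _ _ (fun y => (g, y)) m);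
        last exact: (mulg_continuous (g, x)).
      by apply: cvg_pair; [exact: cvg_cst|exact: cvg_id].
    apply: (@cvg_comp _ _ _ (fun y => (g * y, g^-1)%g) m);
      last exact: (mulg_continuous ((g * x)%g, g^-1%g)).
    by apply: cvg_pair => //; exact: cvg_cst.
  by apply: cg; rewrite mulg1 mulgV.
Qed.

End RoelckeUniformity.

(* [G] with its Roelcke uniformity. *)
Definition roelcke (G : Type) : Type := G.

Section RoelckeSpace.
Variable G : topologicalGroupType.
Let u := let: And3 u _ _ := roelcke_uniformity_coarser G in u.
HB.instance Definition _ := Choice.on (roelcke G).
HB.instance Definition _ := @isUniform.Build (roelcke G) (@roelcke_uniformity G)
  (uniformity_filter u) (uniformity_diagonal u) (uniformity_inv u)
  (uniformity_split u).
End RoelckeSpace.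

(* [i] exhibits [X] as the (Hausdorff) completion of [U]; it is unique up to
   isomorphism. *)
Definition is_completion (U : uniformType) (X : completeType) (i : U -> X) :=
  [/\ hausdorff_space X,
      dense (range i) &
      entourage = filter_from (@entourage X)
                    (fun V => [set x | V (i x.1, i x.2)])].

Definition roelcke_precompact (G : topologicalGroupType) :=
  exists (X : completeType) (i : roelcke G -> X),
    is_completion i /\ compact [set: X].

Section RoelckeAlgebra.
Variables (R : realType) (G : topologicalGroupType).
Local Notation C := (R[i]^o).

Definition rob_pred : {pred G -> C} :=
  fun f => `[< bounded_fun f /\ unif_continuous (f : roelcke G -> C) >].

Lemma robP (f : G -> C) :
  reflect ((exists M : R[i], forall x, `|f x| <= M) /\
           (forall e : R[i], 0 < e ->
              roelcke_uniformity [set x : G * G | `|f x.1 - f x.2| < e]))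
          (f \in rob_pred).
Proof.
have fR : Filter (@roelcke_uniformity G).
  by case: (roelcke_uniformity_coarser G) => /uniformity_filter.
apply: (iffP (asboolP _)) => -[bf uf]; split.
- have [M [_ Mf]] := bf.
  by exists (M + 1) => x; apply: Mf => //; rewrite ltrDl.
- move=> e e0.
  have /uf : entourage [set x : C * C | `|x.1 - x.2| < e].
    by rewrite -entourage_ballE; exists e.
  by [].
- have [M Mf] := bf; exists M; split.
    by apply: ger0_real; apply: le_trans (Mf 1%g); exact: normr_ge0.
  by move=> N MN x _ /=; apply: le_trans (Mf x) (ltW MN).
- move=> V; rewrite -entourage_ballE => -[e /= e0 eV].
  apply: (@filterS _ _ fR _ _ _ (uf e e0)) => -[x y] /= xy.
  by apply: eV; rewrite /= /ball /= /ball_.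
Qed.

Fact rob_subring : subring_closed rob_pred.
Proof.
have fR : Filter (@roelcke_uniformity G).
  by case: (roelcke_uniformity_coarser G) => /uniformity_filter.
split.
- apply/robP; split; first by exists 1 => x; rewrite normr1.
  move=> e e0; apply: (@filterS _ _ fR _ _ _ (@filterT _ _ fR)) => -[x y] _ /=.
  by rewrite subrr normr0.
- move=> f g /robP[[M Mf] uf] /robP[[N Ng] ug]; apply/robP; split.
    exists (M + N) => x; apply: le_trans (ler_normB _ _) _.
    exact: lerD.
  move=> e e0; have e2 : 0 < e / 2 by rewrite divr_gt0.
  apply: (@filterS _ _ fR _ _ _ (@filterI _ _ fR _ _ (uf _ e2) (ug _ e2))).
  move=> [x y] /= [fxy gxy].
  have -> : (f - g) x - (f - g) y = (f x - f y) - (g x - g y).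
    by rewrite !fctE !opprD !opprK addrACA.
  by apply: le_lt_trans (ler_normB _ _) _; rewrite [e]splitr ltrD.
- move=> f g /robP[[M Mf] uf] /robP[[N Ng] ug]; apply/robP.
  have M0 : 0 <= M by apply: le_trans (Mf 1%g); exact: normr_ge0.
  have N0 : 0 <= N by apply: le_trans (Ng 1%g); exact: normr_ge0.
  split.
    by exists (M * N) => x; rewrite normrM; apply: ler_pM.
  move=> e e0; pose K := M + N + 1.
  have K0 : 0 < K by rewrite ltr_wpDl // addr_ge0.
  have d0 : 0 < e / K by rewrite divr_gt0.
  apply: (@filterS _ _ fR _ _ _ (@filterI _ _ fR _ _ (uf _ d0) (ug _ d0))).
  move=> [x y] /= [fxy gxy].
  have -> : (f * g) x - (f * g) y = f x * (g x - g y) + (f x - f y) * g y.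
    by rewrite !fctE mulrBr mulrBl addrA subrK.
  apply: le_lt_trans (ler_normD _ _) _; rewrite !normrM.
  apply: (@le_lt_trans _ _ (M * (e / K) + (e / K) * N)).
    by apply: lerD; apply: ler_pM => //; exact: ltW.
  by rewrite [M * _]mulrC -mulrDr mulrAC ltr_pdivrMr // ltr_pM2l // ltrDl.
Qed.

HB.instance Definition _ := GRing.isSubringClosed.Build _ rob_pred rob_subring.

Fact rob_scaler : GRing.scaler_closed rob_pred.
Proof.
move=> c f rf.
have rc : (fun=> c) \in rob_pred.
  apply/robP; split; first by exists `|c|.
  have [/uniformity_filter fR _ _] := roelcke_uniformity_coarser G.
  move=> e e0; apply: (@filterS _ _ fR _ _ _ (@filterT _ _ fR)) => -[x y] _ /=.
  by rewrite subrr normr0.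
have -> : c *: f = (fun=> c) * f by [].
exact: rpredM.
Qed.

HB.instance Definition _ := GRing.isScaleClosed.Build _ _ rob_pred rob_scaler.

(* Ro_b(G); the involution is [rob_conj] below. *)
Record rob := Rob { rob_fun :> G -> C; rob_funP : rob_fun \in rob_pred }.

HB.instance Definition _ := [isSub for rob_fun].
HB.instance Definition _ := [Choice of rob by <:].
HB.instance Definition _ := GRing.SubChoice_isSubComPzRing.Build
  (G -> C) rob_pred rob rob_subring.
HB.instance Definition _ := [SubZmodule_isSubLmodule of rob by <:].

Lemma rob_conj_subproof (f : rob) : (fun x => (f x)^*%C : C) \in rob_pred.
Proof.
have /robP[[M Mf] uf] := rob_funP f; apply/robP.
have nc (z : C) : `|z^*%C : C| = `|z| by exact: norm_conjC.
split; first by exists M => x; rewrite nc.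
move=> e /uf; congr roelcke_uniformity; apply/seteqP.
by split=> -[x y] /=; rewrite -rmorphB /= nc.
Qed.

Definition rob_conj (f : rob) : rob := Rob (rob_conj_subproof f).

Lemma rob_translate_subproof (g : G) (f : rob) :
  (fun h => f (g^-1 * h)%g) \in rob_pred.
Proof.
have /robP[[M Mf] uf] := rob_funP f; apply/robP.
split; first by exists M => x; exact: Mf.
by move=> e /uf /(roelcke_uniformity_translate g^-1%g).
Qed.

Definition rob_translate (g : G) (f : rob) : rob :=
  Rob (rob_translate_subproof g f).

(* The supremum norm plays no role: unital *-homomorphisms are contractive. *)
Definition is_cstar_hom (phi : rob -> C) :=
  [/\ linear phi, phi 1 = 1, {morph phi : f h / f * h} &
      {morph phi : f / rob_conj f >-> (f^*)%C}].

Record gelfand := Gelfand {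
  gelfand_fun :> rob -> C;
  gelfand_hom : is_cstar_hom gelfand_fun }.

HB.instance Definition _ := gen_eqMixin gelfand.
HB.instance Definition _ := gen_choiceMixin gelfand.
(* The weak* topology is that of pointwise convergence on Ro_b(G). *)
HB.instance Definition _ := Topological.copy gelfand
  (initial_topology (fun phi : gelfand => (phi : rob -> C) : {ptws rob -> C})).

Lemma gelfand_act_subproof (g : G) (phi : gelfand) :
  is_cstar_hom (fun f => phi (rob_translate g^-1%g f)).
Proof.
have [lin one mul conj] := gelfand_hom phi.
split.
- move=> a f h /=; rewrite -lin; congr (phi _); exact: val_inj.
- by rewrite -one; congr (phi _); exact: val_inj.
- by move=> f h; rewrite -mul; congr (phi _); exact: val_inj.
- by move=> f; rewrite -conj; congr (phi _); exact: val_inj.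
Qed.

Definition gelfand_act (g : G) (phi : gelfand) : gelfand :=
  Gelfand (gelfand_act_subproof g phi).

Lemma gelfand_eq (phi psi : gelfand) : phi =1 psi -> phi = psi.
Proof.
case: phi psi => [p hp] [q hq] /= /funext pq; subst q.
by congr Gelfand; exact: Prop_irrelevance.
Qed.

Lemma gelfand_act1 (phi : gelfand) : gelfand_act 1%g phi = phi.
Proof.
apply: gelfand_eq => f /=; congr (phi _); apply: val_inj; apply/funext => h /=.
by rewrite invgK mul1g.
Qed.

Lemma gelfand_actM (g h : G) (phi : gelfand) :
  gelfand_act (g * h)%g phi = gelfand_act g (gelfand_act h phi).
Proof.
apply: gelfand_eq => f /=; congr (phi _); apply: val_inj; apply/funext => k /=.
by rewrite !invgK mulgA.
Qed.

End RoelckeAlgebra.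

Section Automorphisms.
Variables (L : language) (F : structure L).

Record aut := Aut { aut_fun :> F -> F; aut_iso : is_isomorphism aut_fun }.

Lemma aut_eq (g h : aut) : g =1 h -> g = h.
Proof.
case: g h => [g Hg] [h Hh] /= /funext gh; subst h.
by congr Aut; exact: Prop_irrelevance.
Qed.

HB.instance Definition _ := gen_eqMixin aut.
HB.instance Definition _ := gen_choiceMixin aut.

Definition aut_one : aut := Aut (is_isomorphism_id F).

Definition aut_mul (g h : aut) : aut :=
  Aut (is_isomorphism_comp (aut_iso h) (aut_iso g)).

Lemma aut_inv_subproof (g : aut) :
  exists h : aut, cancel g h /\ cancel h g.
Proof. by have [h [hi gh hg]] := is_isomorphism_inv (aut_iso g); exists (Aut hi). Qed.

Definition aut_inv (g : aut) : aut := sval (cid (aut_inv_subproof g)).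

Lemma autK (g : aut) : cancel g (aut_inv g).
Proof. by rewrite /aut_inv; case: cid => h []. Qed.

Lemma autVK (g : aut) : cancel (aut_inv g) g.
Proof. by rewrite /aut_inv; case: cid => h []. Qed.

Let aut_mulA : associative aut_mul. Proof. by move=> f g h; exact: aut_eq. Qed.
Let aut_mul1 : left_id aut_one aut_mul. Proof. by move=> g; exact: aut_eq. Qed.
Let aut_mulr1 : right_id aut_one aut_mul. Proof. by move=> g; exact: aut_eq. Qed.
Let aut_mulV : left_inverse aut_one aut_inv aut_mul.
Proof. by move=> g; apply: aut_eq => x; exact: autK. Qed.
Let aut_mulrV : right_inverse aut_one aut_inv aut_mul.
Proof. by move=> g; apply: aut_eq => x; exact: autVK. Qed.

HB.instance Definition _ := isGroup.Build aut
  aut_mulA aut_mul1 aut_mulr1 aut_mulV aut_mulrV.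

Definition pointwise_stabilizer (S : set F) : set aut :=
  [set g | forall x, S x -> g x = x].

(* The stabilizers of finite sets are the basic neighborhoods of 1, and their
   left translates by g those of g. *)
Definition aut_nbhs (g : aut) : set_system aut :=
  filter_from finite_set (fun S => [set (g * h)%g | h in pointwise_stabilizer S]).

HB.instance Definition _ := hasNbhs.Build aut aut_nbhs.

Let aut_nbhs_filter (g : aut) : ProperFilter (nbhs g).
Proof.
apply: filter_from_proper; last by move=> S _; exists (g * 1)%g, 1%g.
apply: filter_from_filter; first by exists set0.
move=> S T fS fT; exists (S `|` T); first by rewrite finite_setU.
by move=> _ [h hST <-]; split; exists h => // x ?; apply: hST; [left|right].
Qed.

Let aut_nbhs_singleton (g : aut) (V : set aut) : nbhs g V -> V g.
Proof. by move=> [S _]; apply; exists 1%g; rewrite ?mulg1. Qed.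

Lemma pointwise_stabilizerM (S : set F) (g h : aut) :
  pointwise_stabilizer S g -> pointwise_stabilizer S h ->
  pointwise_stabilizer S (g * h)%g.
Proof. by move=> gS hS x Sx; rewrite -[LHS]/(g (h x)) hS // gS. Qed.

Let aut_nbhs_nbhs (g : aut) (V : set aut) : nbhs g V -> nbhs g (nbhs^~ V).
Proof.
move=> [S fS SV]; exists S => // _ [h hS <-]; exists S => // _ [k kS <-].
by apply: SV; exists (h * k)%g; rewrite ?mulgA //; exact: pointwise_stabilizerM.
Qed.

HB.instance Definition _ := Nbhs_isNbhsTopological.Build aut
  aut_nbhs_filter aut_nbhs_singleton aut_nbhs_nbhs.

Lemma pointwise_stabilizerJ (S : set F) (g h : aut) :
  pointwise_stabilizer (g @` S) h -> pointwise_stabilizer S (g^-1 * h * g)%g.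
Proof.
move=> hS x Sx; rewrite -[LHS]/(aut_inv g (h (g x))) hS; first exact: autK.
by exists x.
Qed.

Lemma pointwise_stabilizerV (S : set F) (h : aut) :
  pointwise_stabilizer S h -> pointwise_stabilizer S (h^-1)%g.
Proof. by move=> hS x Sx; rewrite -{1}(hS x Sx); exact: autK. Qed.

Let aut_mul_continuous : continuous (fun x : aut * aut => (x.1 * x.2)%g).
Proof.
move=> [g h] V /= [S fS SV].
exists ([set (g * k)%g | k in pointwise_stabilizer (h @` S)],
        [set (h * k)%g | k in pointwise_stabilizer S]) => /=.
  by split; [exists (h @` S) => //; exact: finite_image|exists S].
move=> [_ _] /= [[k kS <-] [l lS <-]].
apply: SV; exists (h^-1 * k * h * l)%g.
  by apply: pointwise_stabilizerM => //; exact: pointwise_stabilizerJ.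
by rewrite -!mulgA mulVKg.
Qed.

Let aut_inv_continuous : continuous (fun x : aut => x^-1%g).
Proof.
move=> g V /= [S fS SV]; exists (g^-1%g @` S); first exact: finite_image.
move=> _ [k kS <-] /=; apply: SV; exists (g * k^-1 * g^-1)%g.
  rewrite -{1}[g]invgK; apply: pointwise_stabilizerJ.
  exact: pointwise_stabilizerV.
by rewrite invgM -!mulgA mulKg.
Qed.

HB.instance Definition _ := isTopologicalGroup.Build aut
  aut_mul_continuous aut_inv_continuous.

End Automorphisms.

(* Main.v *)
Require Import Defs.
From HB Require Import structures.
From mathcomp Require Import all_boot all_order all_algebra.
From mathcomp Require Import all_classical all_reals all_analysis.
From mathcomp Require Import finmap complex.

Set Implicit Arguments.
Unset Strict Implicit.
Unset Printing Implicit Defensive.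

Import Order.TTheory GRing.Theory Num.Theory.
Import numFieldNormedType.Exports.
Local Open Scope classical_set_scope.
Local Open Scope ring_scope.

(** Write G for Aut(F) and G_S for the pointwise stabilizer of a finite set S.
    Both the fixed point property and the Ramsey property say the same thing
    about colorings of G, namely [finitely_translation_stable]: whenever a
    finite coloring chi of G is constant on the double cosets of some G_S, and
    h_1, ..., h_n are in G, some g has chi (h_i g) = chi g for all i.

    The link with patterns: fix embeddings a0 : A -> F and z0 : Z -> F. By
    ultrahomogeneity every joint embedding pattern of A and Z is of the form
    [g^-1 a0, z0], and g, g' give the same pattern exactly when they lie in the
    same double coset of the stabilizers of a0(A) and z0(Z) ([aut_pattern]).
    So colorings of patterns are double coset invariant colorings of G. The
    copies of A in g^-1(B) are the g^-1 h^-1 a0, where h^-1 a0 runs over the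
    finitely many copies of A in B; so constancy of the color on these copies
    is stability under finitely many translations ([stable_ramsey],
    [ramsey_stable]).

    The link with the Gelfand space: the double cosets of the G_S form a base
    of the Roelcke uniformity ([double_coset_entourage],
    [entourage_double_coset]), so indicators of double coset invariant sets
    lie in the Roelcke algebra. A character takes the values 0 and 1 on them,
    so it selects a filter of sets; if it is fixed, one color class chi^-1(c)
    is selected together with all its translates, and any point of a finite
    intersection of these is the required g ([fixed_stable]). Conversely, the
    sets of those g that satisfy finitely many stability requirements have the
    finite intersection property. The limit of functions along an ultrafilter
    that contains them is a character, and it is fixed because a uniformly
    continuous function is, up to epsilon, controlled by double coset invariant
    sets ([limit_character_fixed]).

    Finally, a Roelcke-precompact G has only finitely many double cosets of
    G_S ([precompact_finite_coloring]), hence there are finitely many patterns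
    of A and Z, and the identity is a finite coloring of them. *)

(** * Finite structures inside an ultrahomogeneous structure *)

Section FiniteStructures.
Variable L : language.
Implicit Types A B D F Z : structure L.

Definition corestrict B D (S : set D) (S0 : S !=set0) (f : embedding B D)
  (fS : forall x, S (f x)) : embedding B (substructure S0).
Proof.
exists (fun x => exist _ (f x) (fS x)); split.
  by move=> x y [/(emb_is_embedding f).1].
by move=> r t; exact: (emb_is_embedding f).2.
Defined.

Definition iso_embedding A B (f : A -> B) (fI : is_isomorphism f) :
  embedding A B := Embedding fI.1.

Lemma corestrict_range_iso B D (f : embedding B D) :
  is_isomorphism (corestrict (range_neq0 f) (fun x => imageT f x)).
Proof.
split; first exact: emb_is_embedding.
apply/seteqP; split=> // -[y yR] _; have [x _ xy] := yR.
by exists x => //; exact: eq_exist.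
Qed.

Lemma in_age_embedding F A : in_age F A -> inhabited (embedding A F).
Proof.
move=> [S [S0 [_ [f fI]]]].
exact: inhabits (emb_comp (sub_incl S0) (iso_embedding fI)).
Qed.

Lemma in_age_finite F A : in_age F A -> finite_set [set: A].
Proof.
move=> [S [S0 [fS [f [[fi _] _]]]]].
pose h (x : A) : F := sval (f x).
have hi : injective h.
  move=> x y hxy; apply: fi; move: hxy; rewrite /h.
  by case: (f x) (f y) => [u Su] [v Sv] /= uv; exact: eq_exist.
have -> : [set: A] = h @^-1` S by apply/seteqP; split=> // x _; exact: svalP (f x).
by apply: finite_preimage => // x y _ _; exact: hi.
Qed.

Lemma in_age_sub F (S : set F) (S0 : S !=set0) :
  finite_set S -> in_age F (substructure S0).
Proof.
by move=> fS; exists S, S0; split=> //; exists id; exact: is_isomorphism_id.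
Qed.

(** Ultrahomogeneity is stated for isomorphisms between substructures; here it
    is turned into the form used throughout: two embeddings of the same finite
    structure differ by an automorphism. *)
Lemma ultrahomogeneous_extension F A (a a' : embedding A F) :
  ultrahomogeneous F -> finite_set [set: A] ->
  exists g : aut F, forall x, g (a x) = a' x.
Proof.
move=> hF fA.
have [b [bI _ bK]] := is_isomorphism_inv (corestrict_range_iso a).
have fI := is_isomorphism_comp bI (corestrict_range_iso a').
have [| |g gI gE] := hF _ _ _ _ _ _ _ fI; [exact: finite_image..|].
exists (Aut gI) => x; rewrite /= -[a x]/(sval (exist _ (a x) (imageT a x))) gE /=.
congr (a' _); apply: (emb_is_embedding a).1.
exact: (congr1 sval (bK (exist _ (a x) (imageT a x)))).
Qed.

(** * Joint embeddings realized in the ambient structure *)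

Section Patterns.
Variables (F A Z : structure L).
Hypothesis hF : ultrahomogeneous F.
Hypotheses (fA : finite_set [set: A]) (fZ : finite_set [set: Z]).
Implicit Types (a : embedding A F) (z : embedding Z F).

Definition joint_set a z : set F := range a `|` range z.

Lemma joint_set_neq0 a z : joint_set a z !=set0.
Proof. by case: (range_neq0 a) => x ax; exists x; left. Qed.

Lemma joint_set_finite a z : finite_set (joint_set a z).
Proof. by rewrite finite_setU; split; exact: finite_image. Qed.

Lemma joint_set_l a z x : joint_set a z (a x). Proof. by left; exists x. Qed.
Lemma joint_set_r a z x : joint_set a z (z x). Proof. by right; exists x. Qed.

(** [joint_in] asks for an ambient structure in the age, which F itself need
    not be; the joint embedding spanned by embeddings into F has to be built
    separately. *)
Definition joint_of a z : joint_embedding F A Z.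
Proof.
refine (@JointEmbedding L F A Z (substructure (joint_set_neq0 a z))
  (corestrict _ (joint_set_l a z)) (corestrict _ (joint_set_r a z)) _
  (in_age_sub _ (joint_set_finite a z))).
apply/seteqP; split=> // -[x xS] _.
by have [[y _ e]|[y _ e]] := xS; [left|right]; exists y => //; exact: eq_exist.
Defined.

Definition pattern_in a z : pattern F A Z := pattern_of (joint_of a z).

(** A pattern can be read off after embedding the common range into F, where
    ultrahomogeneity becomes available. *)
Lemma pattern_of_embedding (j : joint_embedding F A Z)
    (e : embedding (je_range j) F) :
  pattern_of j = pattern_in (emb_comp e (je_left j)) (emb_comp e (je_right j)).
Proof.
apply/pattern_ofP.
have eS x : joint_set (emb_comp e (je_left j)) (emb_comp e (je_right j)) (e x).
  have : [set: je_range j] x by [].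
  by rewrite -je_cover => -[[y _ <-]|[y _ <-]]; [left|right]; exists y.
exists (corestrict _ eS); split=> [|x|x]; [|exact: eq_exist..].
split; first exact: emb_is_embedding.
apply/seteqP; split=> // -[x xS] _; have [[y _ yx]|[y _ yx]] := xS.
  by exists (je_left j y) => //; apply: eq_exist.
by exists (je_right j y) => //; apply: eq_exist.
Qed.

(** An isomorphism of common ranges is an isomorphism between finite
    substructures of F, so it extends to an automorphism. *)
Lemma pattern_inP a z a' z' :
  pattern_in a z = pattern_in a' z' <->
  exists g : aut F, (forall x, g (a x) = a' x) /\ (forall x, g (z x) = z' x).
Proof.
rewrite pattern_ofP; split.
  move=> [c [cI cl cr]].
  have [g gE] := ultrahomogeneous_extension (sub_incl (joint_set_neq0 a z))
    (emb_comp (sub_incl (joint_set_neq0 a' z')) (iso_embedding cI)) hF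
    (in_age_finite (je_in_age (joint_of a z))).
  exists g; split=> x.
    by have := gE (je_left (joint_of a z) x); rewrite /= cl.
  by have := gE (je_right (joint_of a z) x); rewrite /= cr.
move=> [g [ga gz]].
pose gE := iso_embedding (aut_iso g).
have gS x : joint_set a z x -> joint_set a' z' (g x).
  by move=> [[y _ <-]|[y _ <-]]; rewrite ?ga ?gz; [left|right]; exists y.
exists (corestrict (joint_set_neq0 a' z')
  (f := emb_comp gE (sub_incl (joint_set_neq0 a z)))
  (fun u => gS (sval u) (svalP u))); split=> [|x|x]; last 2 first.
- by apply: eq_exist; rewrite /= ga.
- by apply: eq_exist; rewrite /= gz.
split; first exact: emb_is_embedding.
apply/seteqP; split=> // -[x xS] _; have [[y _ yx]|[y _ yx]] := xS.
  by exists (exist _ (a y) (joint_set_l a z y)) => //; apply: eq_exist;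
    rewrite /= ga.
by exists (exist _ (z y) (joint_set_r a z y)) => //; apply: eq_exist;
  rewrite /= gz.
Qed.

End Patterns.
End FiniteStructures.

(** * Colorings of the automorphism group *)

Lemma finite_set_functions (T U : Type) :
  finite_set [set: T] -> finite_set [set: U] -> finite_set [set: T -> U].
Proof.
elim/Pchoice: T => T; elim/Pchoice: U => U.
move=> /finite_seqP[s sE] /finite_seqP[t tE].
have sP x : x \in s by have : [set: T] x by []; rewrite sE.
have tP y : y \in t by have : [set: U] y by []; rewrite tE.
pose code (f : T -> U) :=
  [ffun i : 'I_(size s) => (inord (index (f (tnth (in_tuple s) i)) t) : 'I_(size t).+1)].
have code_inj : {in code @^-1` setT &, injective code}.
  move=> f f' _ _ /ffunP ff'; apply/funext => x.
  have xs : (index x s < size s)%N by rewrite index_mem.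
  have := congr1 (@nat_of_ord _) (ff' (Ordinal xs)); rewrite !ffunE.
  rewrite !inordK ?ltnS ?index_size // (tnth_nth x) /= nth_index //.
  by move=> /(congr1 (nth (f x) t)); rewrite !nth_index.
have := finite_preimage code_inj (@finite_finset _ setT).
by rewrite preimage_setT.
Qed.

Section Colorings.
Variables (L : language) (F : structure L).
Implicit Types (A B Z : structure L) (g h : aut F).

Definition double_coset_invariant T (S : set F) (chi : aut F -> T) :=
  forall s t, pointwise_stabilizer S s -> pointwise_stabilizer S t ->
  forall g, chi (s * g * t)%g = chi g.

(** The condition that mediates between fixed characters and patterns. The
    colors are natural numbers so that two colorings can be merged into one
    by a pairing function, and so that no universe of color types intervenes. *)
Definition finitely_translation_stable :=
  forall (chi : aut F -> nat) (S : set F) (H : set (aut F)),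
    finite_set S -> double_coset_invariant S chi -> finite_set (range chi) ->
    finite_set H ->
    exists g, forall h, H h -> chi (h * g)%g = chi g.

Lemma double_coset_invariantS T (S S' : set F) (chi : aut F -> T) :
  S `<=` S' -> double_coset_invariant S chi -> double_coset_invariant S' chi.
Proof.
by move=> SS' chiS s t sS' tS'; apply: chiS => x /SS'; [exact: sS'|exact: tS'].
Qed.

Definition aut_emb A g (a : embedding A F) : embedding A F :=
  emb_comp (iso_embedding (aut_iso g)) a.

(** All patterns that the Ramsey property compares inside one joint embedding
    are computed in F through a single embedding of its common range. *)
Lemma sub_pattern_in A B Z (fA : finite_set [set: A]) (fZ : finite_set [set: Z])
    (hF : ultrahomogeneous F) (j : joint_embedding F B Z)
    (e : embedding (je_range j) F) (a : embedding A (image_structure (je_left j))) :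
  sub_pattern a = pattern_in fA fZ
    (emb_comp e (emb_comp (sub_incl (range_neq0 (je_left j))) a))
    (emb_comp e (je_right j)).
Proof.
rewrite /sub_pattern; set k := joint_in _ _ _.
rewrite (pattern_of_embedding fA fZ
  (emb_comp e (sub_incl _) : embedding (je_range k) F)).
by apply/pattern_inP => //; exists 1%g.
Qed.

Section PatternColoring.
Hypothesis hF : ultrahomogeneous F.
Variables A Z : structure L.
Hypotheses (fA : finite_set [set: A]) (fZ : finite_set [set: Z]).
Variables (a0 : embedding A F) (z0 : embedding Z F).

(** The inverse turns the left translations of G, for which characters are
    fixed, into moves of the copy of A; the copy of Z stays put. *)
Definition aut_pattern g : pattern F A Z :=
  pattern_in fA fZ (aut_emb g^-1%g a0) z0.

Lemma aut_pattern_invariant : double_coset_invariant (joint_set a0 z0) aut_pattern.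
Proof.
move=> s t sS tS g; apply/pattern_inP => //; exists t; split=> x.
  rewrite -[LHS]/((t * (s * g * t)^-1)%g (a0 x)).
  rewrite !invgM mulVKg -[LHS]/(g^-1%g (s^-1%g (a0 x))).
  by rewrite (pointwise_stabilizerV sS) //; exact: joint_set_l.
by rewrite tS //; exact: joint_set_r.
Qed.

Lemma aut_pattern_double_coset g g' : aut_pattern g = aut_pattern g' ->
  exists s t : aut F, [/\ forall x, s (a0 x) = a0 x, forall x, t (z0 x) = z0 x &
                  g' = (s * g * t)%g].
Proof.
move=> /pattern_inP -/(_ hF)[t [ta tz]].
exists (g' * t * g^-1)%g, t^-1%g; split.
- move=> x; rewrite -[LHS]/(g' (t (g^-1%g (a0 x)))) ta; exact: autVK.
- by move=> x; rewrite -{1}tz; exact: autK.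
- by rewrite mulgVK mulgK.
Qed.

(** Any joint embedding in F can be moved so that Z is placed by z0; then A is
    placed by some translate of a0. *)
Lemma aut_pattern_surj p : exists g, p = aut_pattern g.
Proof.
have [j ->] : exists j, p = pattern_of j.
  by case: p => P [j Pj]; exists j; exact: eq_exist.
have [e] := in_age_embedding (je_in_age j).
have [k kE] := ultrahomogeneous_extension (emb_comp e (je_right j)) z0 hF fZ.
have [h hE] := ultrahomogeneous_extension (aut_emb k (emb_comp e (je_left j)))
  a0 hF fA.
exists h; rewrite (pattern_of_embedding fA fZ e); apply/pattern_inP => //.
exists k; split=> // x.
by have := autK h (aut_emb k (emb_comp e (je_left j)) x); rewrite hE.
Qed.

End PatternColoring.

Definition ramsey_property :=
  forall A B Z, in_age F A -> in_age F B -> in_age F Z ->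
  forall (T : Type) (gamma : pattern F A Z -> T), finite_set (range gamma) ->
  exists j : joint_embedding F B Z,
    forall a a' : embedding A (image_structure (je_left j)),
      gamma (sub_pattern a) = gamma (sub_pattern a').

Hypothesis hF : ultrahomogeneous F.

(** If g is stable for the translations that relate the copies of A in B to
    a0, then the copy g^-1(B) together with z0 is monochromatic. *)
Lemma stable_ramsey : finitely_translation_stable -> ramsey_property.
Proof.
move=> stable A B Z FA FB FZ T gamma fgamma.
have fA := in_age_finite FA; have fB := in_age_finite FB.
have fZ := in_age_finite FZ.
have [a0] := in_age_embedding FA; have [b0] := in_age_embedding FB.
have [z0] := in_age_embedding FZ.
have [k k_inj] := countable_injP _ (finite_set_countable fgamma).
pose chi g := k (gamma (aut_pattern fA fZ a0 z0 g)).
(* One automorphism for each copy of A in B carries that copy onto a0(A). *)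
pose copies (f : A -> B) := [set h : aut F | forall x, h (b0 (f x)) = a0 x].
pose H := range (fun f => xget 1%g (copies f)).
have [||||g gH] := stable chi (joint_set a0 z0) H.
- exact: joint_set_finite.
- by move=> s t sS tS g; rewrite /chi aut_pattern_invariant.
- apply: sub_finite_set (finite_image k fgamma) => _ [g _ <-].
  by exists (gamma (aut_pattern fA fZ a0 z0 g)) => //; exact: imageT.
- exact/finite_image/finite_set_functions.
pose j := joint_of fB fZ (aut_emb g^-1%g b0) z0.
pose e : embedding (je_range j) F := sub_incl _.
exists j.
suff mono (a : embedding A (image_structure (je_left j))) :
    gamma (sub_pattern a) = gamma (aut_pattern fA fZ a0 z0 g).
  by move=> a a'; rewrite !mono.
(* A copy a of A in g^-1(B) comes from a copy f of A in B. *)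
have af x : exists y, je_left j y = sval (a x).
  by have [y _ <-] := svalP (a x); exists y.
pose f x := sval (cid (af x)).
have fE x : e (sval (a x)) = g^-1%g (b0 (f x)).
  by rewrite /f; case: cid => y /= <-.
have f_emb : is_embedding f.
  have lE x : je_left j (f x) = sval (a x) by rewrite /f; case: cid.
  split.
    move=> x y fxy; have := lE x; rewrite fxy lE => axy.
    exact: (emb_is_embedding (emb_comp (sub_incl _) a)).1.
  move=> r t; rewrite -(emb_is_embedding (je_left j)).2.
  rewrite -(emb_is_embedding (emb_comp (sub_incl (range_neq0 (je_left j))) a)).2.
  have -> // : je_left j \o (f \o t) =
      emb_comp (sub_incl (range_neq0 (je_left j))) a \o t.
  by apply/funext => i; exact: lE.
have copy : copies f (xget 1%g (copies f)).
  apply: xgetPex.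
  have [h hE] := ultrahomogeneous_extension
    (emb_comp b0 (Embedding f_emb)) a0 hF fA.
  by exists h.
set h := xget _ _ in copy.
apply: k_inj; [apply: mem_set; exact: imageT..|].
rewrite -[RHS](gH h); last by exists f.
congr (k (gamma _)); rewrite (sub_pattern_in fA fZ hF e).
apply/pattern_inP => //; exists 1%g; split=> // x.
rewrite -[LHS]/(e (sval (a x))) fE -[RHS]/((h * g)^-1%g (a0 x)) -copy.
by rewrite -[RHS]/(((h * g)^-1 * h)%g (b0 (f x))) invgM mulgVK.
Qed.

(** Take A = Z = S, so that a double coset invariant coloring of G becomes a
    coloring of patterns, and let B contain the translates h^-1(S). *)
Lemma ramsey_stable : ramsey_property -> finitely_translation_stable.
Proof.
move=> ramsey chi S H fS chiS fchi fH.
have [x0 _] := carrier_neq0 F.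
(* Structures are nonempty, hence the additional point x0; including the
   identity in H1 provides the reference color chi g. *)
pose S1 := x0 |` S; have S1_0 : S1 !=set0 by exists x0; left.
have fS1 : finite_set S1 by rewrite finite_setU.
pose H1 := 1%g |` H; have fH1 : finite_set H1 by rewrite finite_setU.
pose S2 := \bigcup_(h in H1) (h^-1%g @` S1).
have fS2 : finite_set S2 by apply: bigcup_finite => // h _; exact: finite_image.
have S2_0 : S2 !=set0.
  by exists (((1^-1)%g : aut F) x0), 1%g; [left|exists x0 => //; left].
have FA := in_age_sub S1_0 fS1; have FB := in_age_sub S2_0 fS2.
have fA := in_age_finite FA; have fB := in_age_finite FB.
pose a0 := sub_incl S1_0; pose b0 := sub_incl S2_0.
pose pat := aut_pattern fA fA a0 a0.
have chi_pat g g' : pat g = pat g' -> chi g = chi g'.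
  move=> /(aut_pattern_double_coset hF)[s [t [sS tS ->]]]; symmetry.
  apply: (double_coset_invariantS (@subsetUr _ [set x0] S) chiS) => x xS.
    exact: (sS (exist _ x xS)).
  exact: (tS (exist _ x xS)).
pose gamma p := chi (sval (cid (aut_pattern_surj hF fA fA a0 a0 p))).
have gammaE g : gamma (pat g) = chi g.
  by rewrite /gamma; case: cid => g' /= /chi_pat.
have [|j jP] := ramsey _ _ _ FA FB FA _ gamma.
  by apply: sub_finite_set fchi => _ [p _ <-]; exact: imageT.
have [e] := in_age_embedding (je_in_age j).
(* Place the joint embedding in F with Z at its standard position, and read
   off g from the position of B. *)
have [k kE] := ultrahomogeneous_extension (emb_comp e (je_right j)) a0 hF fA.
have [g gE] := ultrahomogeneous_extension
  (aut_emb k (emb_comp e (je_left j))) b0 hF fB.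
have sub h : H1 h -> forall x : substructure S1_0, S2 (h^-1%g (sval x)).
  by move=> Hh x; exists h => //; exists (sval x) => //; exact: svalP x.
pose sub_emb h (Hh : H1 h) : embedding (substructure S1_0) (substructure S2_0) :=
  corestrict S2_0 (f := aut_emb h^-1%g a0) (sub h Hh).
pose copy h Hh : embedding (substructure S1_0) (image_structure (je_left j)) :=
  corestrict (range_neq0 (je_left j)) (f := emb_comp (je_left j) (sub_emb h Hh))
    (fun x => imageT _ _).
have copyE h Hh : gamma (sub_pattern (copy h Hh)) = chi (h * g)%g.
  rewrite -gammaE; congr gamma.
  rewrite (sub_pattern_in fA fA hF (aut_emb k e)).
  apply/pattern_inP => //; exists 1%g; split=> x; last exact: kE.
  have -> : aut_emb (h * g)^-1%g a0 x = g^-1%g (b0 (sub_emb h Hh x)).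
    by rewrite /aut_emb invgM.
  by rewrite -gE; symmetry; exact: autK.
have H1_1 : H1 1%g by left.
exists g => h Hh; have Hh' : H1 h by right.
by rewrite -(copyE h Hh') -[g in RHS]mul1g -(copyE 1%g H1_1).
Qed.

End Colorings.

(** * The Roelcke uniformity of an automorphism group *)

Section RoelckeAut.
Variables (L : language) (F : structure L).
Implicit Types (S : set F) (g h : aut F).

Lemma nbhs_stabilizer S : finite_set S -> nbhs (1%g : aut F) (pointwise_stabilizer S).
Proof. by move=> fS; exists S => // _ [h hS <-]; rewrite mul1g. Qed.

(** The sets that contain the graph of the double coset relation of one fixed
    G_S form a uniformity, because this relation is an equivalence; it is
    coarser than the left and the right uniformity because it contains both
    g ~ g t and g ~ s g. *)
Lemma double_coset_entourage S (V : set (aut F * aut F)) : finite_set S ->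
  (forall s t, pointwise_stabilizer S s -> pointwise_stabilizer S t ->
     forall g, V (g, s * g * t)%g) ->
  roelcke_uniformity V.
Proof.
move=> fS VS.
have stab1 : pointwise_stabilizer S (1%g : aut F) by [].
exists [set V | forall s t, pointwise_stabilizer S s ->
  pointwise_stabilizer S t -> forall g, V (g, s * g * t)%g] => //.
split; first split.
- split=> //.
  + by move=> P Q SP SQ s t sS tS g; split; [exact: SP|exact: SQ].
  + by move=> P Q PQ SP s t sS tS g; apply: PQ; exact: SP.
- move=> W SW [g g'] gg'; have <- : g = g' := gg'.
  by have := SW _ _ stab1 stab1 g; rewrite mul1g mulg1.
- move=> W SW s t sS tS g.
  have := SW _ _ (pointwise_stabilizerV sS) (pointwise_stabilizerV tS) (s * g * t)%g.
  by rewrite !mulgA mulVg mul1g mulgK.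
- move=> W SW.
  exists [set x | exists s t, [/\ pointwise_stabilizer S s,
      pointwise_stabilizer S t & x.2 = (s * x.1 * t)%g]].
    by move=> s t sS tS g; exists s, t.
  move=> [g g'] /= [k [s [t [sS tS /= ->]]] [s' [t' [sS' tS' /= ->]]]].
  have := SW _ _ (pointwise_stabilizerM sS' sS) (pointwise_stabilizerM tS tS') g.
  by rewrite !mulgA.
- move=> W SW; exists (pointwise_stabilizer S); first exact: nbhs_stabilizer.
  by move=> [g g'] /= gS; have := SW _ _ stab1 gS g; rewrite mul1g mulVKg.
- move=> W SW; exists (pointwise_stabilizer S); first exact: nbhs_stabilizer.
  move=> [g g'] /= /pointwise_stabilizerV gS; have := SW _ _ gS stab1 g.
  by rewrite mulg1 invgM invgK mulgVK.
Qed.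

(** Going from g to s g t takes a small step g, g t for the left uniformity
    and a small step g t, s g t for the right one; an entourage of a uniformity
    coarser than both absorbs their composition. *)
Lemma entourage_double_coset (V : set (aut F * aut F)) : roelcke_uniformity V ->
  exists2 S, finite_set S & forall s t, pointwise_stabilizer S s ->
    pointwise_stabilizer S t -> forall g, V (g, s * g * t)%g.
Proof.
move=> [E [u l r] EV]; have [W EW WV] := uniformity_split u EV.
have [U [S fS SU] UW] := l _ EW; have [U' [S' fS' SU'] UW'] := r _ EW.
exists (S `|` S'); first by rewrite finite_setU.
move=> s t sS tS g; apply: WV; exists (g * t)%g.
  apply: UW; apply: SU; exists t; last by rewrite /= mul1g mulKg.
  by move=> x xS; apply: tS; left.
apply: UW'; apply: SU'; exists s^-1%g.
  by apply: pointwise_stabilizerV => x xS; apply: sS; right.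
by rewrite /= mul1g !invgM !mulgA mulgK mulgV mul1g.
Qed.

(** With infinitely many colors, the sets of points that avoid finitely many
    colors generate a proper filter. Near a cluster point of its image in the
    completion, any two elements have the same color, although one of them can
    be chosen to avoid the color of the other. *)
Lemma precompact_finite_coloring T S (chi : aut F -> T) :
  roelcke_precompact (aut F) -> finite_set S ->
  double_coset_invariant S chi -> finite_set (range chi).
Proof.
move=> [X [i [[_ _ iE] cX]]] fS chiS; apply: contrapT => infchi.
pose E := [set x : roelcke (aut F) * roelcke (aut F) | chi x.1 = chi x.2].
have : entourage E.
  by apply: (double_coset_entourage fS) => s t sS tS g; rewrite /E /= chiS.
rewrite iE => -[V entV VE].
pose B (P : set T) := [set i g | g in [set g | ~ P (chi g)]].
have B_proper : ProperFilter (filter_from finite_set B).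
  apply: filter_from_proper.
    apply: filter_from_filter; first by exists set0.
    move=> P Q fP fQ; exists (P `|` Q); first by rewrite finite_setU.
    by move=> _ [g gPQ <-]; split; exists g => //= ?; apply: gPQ; [left|right].
  move=> P fP; apply: contrapT => PB; apply: infchi.
  apply: sub_finite_set fP => _ [g _ <-]; apply: contrapT => Pg.
  by apply: PB; exists (i g), g.
have [|x [_ clx]] := cX _ B_proper; first by exists set0.
pose W := split_ent V `&` ((split_ent V)^-1)%relation.
have xW : nbhs x (xsection W x).
  by apply: nbhs_entourage; apply: filterI; last apply: entourage_inv;
    exact: entourage_split_ent.
have meet P : finite_set P -> exists g, ~ P (chi g) /\ W (x, i g).
  move=> fP; have BP : filter_from finite_set B (B P) by exists P.
  have [_ [[g gP <-] gW]] := clx _ _ BP xW.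
  by exists g; split=> //; exact/xsectionP.
have [g [_ [_ gx]]] := meet _ (@finite_set0 T).
have [g' [g'g [xg' _]]] := meet _ (finite_set1 (chi g)).
by apply: g'g; symmetry; apply: (VE (g, g')); exact: entourage_split gx xg'.
Qed.

End RoelckeAut.

(** * Fixed characters of the Roelcke algebra *)

Section Characters.
Variables (R : realType) (L : language) (F : structure L).
Local Notation G := (aut F).
Local Notation C := (R[i]^o).
Implicit Types (g h : G) (f : rob R G).

Lemma robE1 g : (1 : rob R G) g = 1. Proof. by []. Qed.
Lemma robEM f1 f2 g : (f1 * f2) g = f1 g * f2 g. Proof. by []. Qed.
Lemma robEB f1 f2 g : (f1 - f2) g = f1 g - f2 g. Proof. by []. Qed.

Section FixedCharacter.
Variable phi : gelfand R G.

Definition indicator_in (X : set G) f := forall g, f g = (`[< X g >])%:R.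

Definition large (X : set G) := exists2 f, indicator_in X f & phi f = 1.

Lemma invariant_indicator (S : set F) (X : set G) : finite_set S ->
  double_coset_invariant S X -> exists f, indicator_in X f.
Proof.
move=> fS XS; pose f g : C := (`[< X g >])%:R.
have fP : f \in @rob_pred R G.
  apply/robP; split.
    by exists 1 => g; rewrite /f; case: asbool; rewrite ?normr1 ?normr0.
  move=> e e0; apply: (double_coset_entourage fS) => s t sS tS g /=.
  by rewrite /f XS // subrr normr0.
by exists (Rob fP).
Qed.

(** The indicator is idempotent, so the character maps it to 0 or 1. *)
Lemma large_or_complement X f : indicator_in X f -> large X \/ large (~` X).
Proof.
move=> fX; have [lin one mul _] := gelfand_hom phi.
have ff : f * f = f.
  apply: val_inj; apply/funext => g; rewrite -[LHS]/(f g * f g) -[RHS]/(f g) fX.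
  by case: asbool; rewrite ?mulr1 ?mulr0.
have : phi f * (phi f - 1) == 0 by rewrite mulrBr mulr1 -mul ff subrr.
rewrite mulf_eq0 subr_eq0 => /orP[/eqP f0|/eqP f1]; last by left; exists f.
right; exists (1 - f).
  by move=> g; rewrite robEB robE1 fX asbool_neg; case: asbool; rewrite ?subrr ?subr0.
have -> : 1 - f = (-1) *: f + 1 by rewrite scaleN1r addrC.
by rewrite lin f0 one scaler0 add0r.
Qed.

(** Large sets are nonempty since the indicator of the empty set is 0, and
    closed under intersection since characters are multiplicative. *)
Lemma large_filter : ProperFilter (filter_from large id).
Proof.
have [lin one mul _] := gelfand_hom phi.
have phi0 : phi 0 = 0.
  have := lin (-1) 1 1; rewrite scaleN1r addNr => ->.
  by rewrite scaleN1r addNr.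
apply: filter_from_proper.
  apply: filter_from_filter.
    by exists setT, 1 => // g; rewrite robE1 asboolT.
  move=> X Y [f fX f1] [f' fY f'1]; exists (X `&` Y) => //.
  exists (f * f'); last by rewrite mul f1 f'1 mulr1.
  by move=> g; rewrite robEM fX fY asbool_and -natrM mulnb.
move=> X [f fX f1]; apply: contrapT => X0.
have : f = 0.
  apply: val_inj; apply/funext => g; rewrite /= fX asboolF // => Xg.
  by apply: X0; exists g.
move=> f0; move: f1; rewrite f0 phi0 => /eqP.
by rewrite eq_sym oner_eq0.
Qed.

Hypothesis phi_fixed : forall g, gelfand_act g phi = phi.

Lemma large_translate X h : large X -> large [set g | X (h * g)%g].
Proof.
move=> [f fX f1]; exists (rob_translate h^-1%g f).
  by move=> g /=; rewrite invgK fX.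
by rewrite -f1 -{2}(phi_fixed h).
Qed.

(** Some color class is large, for otherwise the complements of the finitely
    many classes would be large and have a common point. Its translates are
    large too, and stability holds at any point of their intersection. *)
Lemma fixed_stable : finitely_translation_stable F.
Proof.
move=> chi S H fS chiS fchi fH.
have LF := large_filter.
have dci (c : nat) : double_coset_invariant S [set g | chi g = c].
  by move=> s t sS tS g; rewrite /= chiS.
have [c lc] : exists c, large [set g | chi g = c].
  apply: contrapT => noc.
  have [D DE] := finite_fsetP.1 fchi.
  have : filter_from large id (\bigcap_(c in [set` D]) [set g | chi g <> c]).
    apply: filter_bigI => c _; have [f fc] := invariant_indicator fS (dci c).
    have [lc|lc] := large_or_complement fc; first by case: noc; exists c.
    by exists (~` [set g | chi g = c]).
  rewrite -DE => /filter_ex[g /(_ (chi g) (imageT _ _))]; exact.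
have [D DE] := finite_fsetP.1 fH.
have : filter_from large id
    ([set g | chi g = c] `&` \bigcap_(h in [set` D]) [set g | chi (h * g)%g = c]).
  apply: filterI; first by exists [set g | chi g = c].
  apply: filter_bigI => h _; exists [set g | chi (h * g)%g = c] => //.
  exact: (large_translate h lc).
move=> /filter_ex[g [gc Hg]]; exists g => h; rewrite DE => Hh.
by rewrite gc; exact: Hg.
Qed.

End FixedCharacter.

(** * Invariant characters as limits along an ultrafilter *)

Definition translation_invariant_colors (U : set_system G) :=
  forall (chi : G -> nat) (S : set F) h, finite_set S ->
    double_coset_invariant S chi -> finite_set (range chi) ->
    \forall g \near U, chi (h * g)%g = chi g.

(** Stability says that the basic sets [B i] below are nonempty. They form a
    filter base since two tests combine into one for the paired coloring. *)
Lemma stable_ultrafilter : finitely_translation_stable F ->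
  exists2 U : set_system G, UltraFilter U & translation_invariant_colors U.
Proof.
move=> stable.
pose test (i : (G -> nat) * set F * set G) :=
  [/\ finite_set i.1.2, double_coset_invariant i.1.2 i.1.1,
      finite_set (range i.1.1) & finite_set i.2].
pose B (i : (G -> nat) * set F * set G) :=
  [set g | forall h, i.2 h -> i.1.1 (h * g)%g = i.1.1 g].
have : ProperFilter (filter_from test B).
  apply: filter_from_proper; last first.
    by move=> [[chi S] H] [/= fS chiS fchi fH]; exact: (stable chi S H).
  apply: filter_from_filter.
    exists ((fun=> 0%N), set0, set0); split=> //=.
    exact: (@finite_image_cst G nat 0%N).
  move=> [[chi S] H] [[chi' S'] H'] [/= fS chiS fchi fH] [/= fS' chiS' fchi' fH'].
  exists ((fun g => choice.pickle (chi g, chi' g)), S `|` S', H `|` H').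
    split=> /=; rewrite ?finite_setU //.
      move=> s t sS tS g; congr choice.pickle; congr pair.
        exact: (double_coset_invariantS (@subsetUl _ _ S') chiS).
      exact: (double_coset_invariantS (@subsetUr _ S _) chiS').
    apply: sub_finite_set (finite_image (@choice.pickle (nat * nat)%type) (finite_setX fchi fchi')).
    by move=> _ [g _ <-]; exists (chi g, chi' g) => //; split; exact: imageT.
  move=> g gHH'; split=> h /= Hh.
    have /(pcan_inj choice.pickleK)[//] := gHH' h (or_introl Hh).
  have /(pcan_inj choice.pickleK)[//] := gHH' h (or_intror Hh).
move=> /ultraFilterLemma[U [UU BU]]; exists U => // chi S h fS chiS fchi.
apply: BU; exists (chi, S, [set h]); first by split=> //; exact: finite_set1.
by move=> g /(_ h erefl).
Qed.

(** The cluster point of the image filter given by compactness is a limit,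
    since an ultrafilter decides every neighborhood. *)
Lemma ultra_cvg_bounded (T : Type) (U : set_system T) (u : T -> R) (M : R) :
  UltraFilter U -> (forall x, `|u x| <= M) -> exists l : R, u @ U --> l.
Proof.
move=> UU uM.
have := @segment_compact R (- M) M.
have PU : ProperFilter (u @ U) by exact: fmap_proper_filter.
move=> /(_ (u @ U) PU)[|l [_ cl]].
  have : U (u @^-1` `[- M, M]) by apply: filterE => x /=; rewrite in_itv /= -ler_norml.
  by [].
exists l => A lA; have [//|UA] := in_ultra_setVsetC (u @^-1` A) UU.
by have [x []] := cl (~` A) A UA lA.
Qed.

Lemma normc_ge_Im (z : R[i]) : (`|complex.Im z|)%:C%C <= `|z|.
Proof.
by rewrite normc_def lecR -sqrtr_sqr ler_wsqrtr // lerDr sqr_ge0.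
Qed.

Lemma normc_le_ReIm (z : R[i]) :
  `|z| <= (`|complex.Re z| + `|complex.Im z|)%:C%C.
Proof.
rewrite normc_def lecR; set a := complex.Re z; set b := complex.Im z.
have ab0 : 0 <= `|a| + `|b| by rewrite addr_ge0.
rewrite -[leRHS]ger0_norm // -[leRHS]sqrtr_sqr ler_wsqrtr // sqrrD.
by rewrite !real_normK ?num_real // addrAC lerDl mulrn_wge0 // mulr_ge0.
Qed.

Lemma ultra_cvg_complex (T : Type) (U : set_system T) (u : T -> C) (M : R[i]) :
  UltraFilter U -> (forall x, `|u x| <= M) -> exists l : C, u @ U --> l.
Proof.
move=> UU uM.
have bound (v : T -> R) : (forall x, (`|v x|)%:C%C <= `|u x|) ->
    exists l : R, v @ U --> l.
  move=> vu; apply: (@ultra_cvg_bounded _ _ _ (complex.Re M)) => // x.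
  by have := le_trans (vu x) (uM x); rewrite lecE => /andP[].
have [a ua] := bound (fun x => complex.Re (u x)) (fun x => normc_ge_Re (u x)).
have [b ub] := bound (fun x => complex.Im (u x)) (fun x => normc_ge_Im (u x)).
exists (a +i* b)%C; apply/cvgrPdist_lt => e e0.
have e2 : 0 < complex.Re e / 2.
  by rewrite divr_gt0 //; move: e0; rewrite ltcE => /andP[].
have eE : e = (complex.Re e)%:C%C.
  by move: e0; rewrite ltcE => /andP[/eqP im _]; case: e im {e2} => x y /= ->.
move/cvgrPdist_lt : ua => /(_ _ e2) ua; move/cvgrPdist_lt : ub => /(_ _ e2) ub.
near=> x.
apply: le_lt_trans (normc_le_ReIm _) _; rewrite eE ltcR [ltRHS]splitr.
rewrite !raddfB /=; apply: ltrD.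
  by near: x.
by near: x.
Unshelve. all: by end_near.
Qed.

Section LimitCharacter.
Variable U : set_system G.
Hypothesis UU : UltraFilter U.

Lemma rob_cvg f : exists l : C, f @ U --> l.
Proof.
by have /robP[[M fM] _] := rob_funP f; exact: ultra_cvg_complex UU fM.
Qed.

Definition ultralimit f : C := sval (cid (rob_cvg f)).

Lemma ultralimitP f : f @ U --> ultralimit f.
Proof. by rewrite /ultralimit; case: cid. Qed.

Lemma ultralimit_unique f (l : C) : f @ U --> l -> ultralimit f = l.
Proof.
by move=> fl; apply: (cvg_unique (@norm_hausdorff _ C) (@ultralimitP f) fl).
Qed.

Lemma ultralimit_cstar_hom : is_cstar_hom ultralimit.
Proof.
split.
- move=> a f k; apply: ultralimit_unique.
  apply: cvgD; last exact: ultralimitP.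
  by apply: cvgM; [exact: cvg_cst|exact: ultralimitP].
- by apply: ultralimit_unique; exact: cvg_cst.
- by move=> f k; apply: ultralimit_unique; apply: cvgM; exact: ultralimitP.
- move=> f; apply: ultralimit_unique; apply/cvgrPdist_lt => e e0.
  have /cvgrPdist_lt/(_ e e0) := @ultralimitP f.
  by apply: filterS => g /=; rewrite -rmorphB /= normcJ.
Qed.

Definition limit_character := Gelfand ultralimit_cstar_hom.

(** Let f converge to l along U. Saturating the set where f is close to l by the
    double cosets on which f hardly varies gives an invariant set X; as U
    cannot distinguish X from its translate by h, the translate of f is close
    to l as well. *)
Lemma limit_character_fixed : translation_invariant_colors U ->
  forall g, gelfand_act g limit_character = limit_character.
Proof.
move=> inv h; apply: gelfand_eq => f /=; apply: ultralimit_unique.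
set l := ultralimit f; apply/cvgrPdist_lt => e e0.
have e2 : 0 < e / 2 by rewrite divr_gt0.
have /robP[_ /(_ _ e2) /entourage_double_coset[S fS fSe]] := rob_funP f.
pose X g := exists s t, [/\ pointwise_stabilizer S s,
  pointwise_stabilizer S t & `|l - f (s * g * t)%g| < e / 2].
pose chi g := nat_of_bool `[< X g >].
have chiS : double_coset_invariant S chi.
  move=> s t sS tS g; congr nat_of_bool; apply: asbool_equiv_eq; split.
    move=> [s' [t' [sS' tS' fX]]]; exists (s' * s)%g, (t * t')%g.
    split; try exact: pointwise_stabilizerM.
    by rewrite !mulgA in fX *.
  move=> [s' [t' [sS' tS' fX]]]; exists (s' * s^-1)%g, (t^-1 * t')%g.
  split; [|exact: pointwise_stabilizerM (pointwise_stabilizerV tS) tS'|].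
    exact: pointwise_stabilizerM sS' (pointwise_stabilizerV sS).
  by rewrite !mulgA mulgVK mulgK.
have fchi : finite_set (range chi).
  apply: sub_finite_set (finite_image nat_of_bool (@finite_finset _ [set: bool])).
  by move=> _ [g _ <-]; exact: imageT.
have /cvgrPdist_lt/(_ _ e2) near_l := @ultralimitP f.
have := inv chi S h fS chiS fchi.
apply: filterS2 near_l => g fgl chig /=.
have : X (h * g)%g.
  have : `[< X g >] by apply/asboolP; exists 1%g, 1%g; rewrite mul1g mulg1.
  by move: chig; rewrite /chi => + Xg; rewrite Xg; case: asboolP.
move=> [s [t [sS tS fX]]]; rewrite invgK [e]splitr.
rewrite -(subrK (f (s * (h * g) * t)%g) l) -addrA.
apply: le_lt_trans (ler_normD _ _) _; apply: ltrD => //.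
rewrite distrC; exact: fSe.
Qed.

End LimitCharacter.

Lemma fixed_character_stable :
  (exists phi : gelfand R G, forall g, gelfand_act g phi = phi) <->
  finitely_translation_stable F.
Proof.
split=> [[phi phi_fixed]|/stable_ultrafilter[U UU inv]].
  exact: fixed_stable phi_fixed.
by exists (limit_character UU); exact: limit_character_fixed.
Qed.

End Characters.

(** * Finiteness of patterns and the equivalences *)

Lemma precompact_finite_patterns (L : language) (F A Z : structure L) :
  ultrahomogeneous F -> roelcke_precompact (aut F) ->
  in_age F A -> in_age F Z -> finite_set [set: pattern F A Z].
Proof.
move=> hF pF FA FZ; have fA := in_age_finite FA; have fZ := in_age_finite FZ.
have [a0] := in_age_embedding FA; have [z0] := in_age_embedding FZ.
have := precompact_finite_coloring pF (joint_set_finite fA fZ a0 z0)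
  (aut_pattern_invariant hF fA fZ (a0 := a0) (z0 := z0)).
apply: sub_finite_set => p _.
by have [g ->] := aut_pattern_surj hF fA fZ a0 z0 p; exact: imageT.
Qed.

Theorem theorem4 (R : realType) (L : language) (F : structure L)
    (hF : fraisse_structure F) :
  let fixed_point :=
    exists phi : gelfand R (aut F), forall g : aut F, gelfand_act g phi = phi in
  let ramsey :=
    forall A B Z : structure L, in_age F A -> in_age F B -> in_age F Z ->
    forall (T : Type) (gamma : pattern F A Z -> T), finite_set (range gamma) ->
    exists j : joint_embedding F B Z,
      forall a a' : embedding A (image_structure (je_left j)),
        gamma (sub_pattern a) = gamma (sub_pattern a') in
  let pattern_ramsey :=
    forall A B Z : structure L, in_age F A -> in_age F B -> in_age F Z ->
    exists j : joint_embedding F B Z,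
      forall a a' : embedding A (image_structure (je_left j)),
        sub_pattern a = sub_pattern a' in
  (fixed_point <-> ramsey) /\
  (roelcke_precompact (aut F) ->
     (fixed_point <-> pattern_ramsey) /\ (ramsey <-> pattern_ramsey)).
Proof.
move=> fixed_point ramsey pattern_ramsey; have hU := hF.2.
have fixed_ramsey : fixed_point <-> ramsey.
  rewrite /fixed_point fixed_character_stable; split.
    exact: stable_ramsey.
  exact: ramsey_stable.
split=> // pF.
have ramsey_pattern : ramsey <-> pattern_ramsey.
  split=> [ram A B Z FA FB FZ|pat A B Z FA FB FZ T gamma _].
    apply: (ram A B Z FA FB FZ _ id).
    exact: sub_finite_set (@subsetT _ _)
      (precompact_finite_patterns hU pF FA FZ).
  have [j jP] := pat A B Z FA FB FZ.
  by exists j => a a'; rewrite (jP a a').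
by split=> //; rewrite fixed_ramsey.
Qed.
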